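(* Let $\mathcal{I}_{Lip}^{1}$ and $\mathcal{I}_{Lip}^{2}$ be Lipschitz operator ideals. Then the following assertions are equivalent. (1) The two-Lipschitz operator ideal $[\mathcal{I}_{Lip}^{1},\mathcal{I}_{Lip}^{2}]$ is symmetric. (2) $[\mathcal{I}_{Lip}^{1},\mathcal{I}_{Lip}^{2}]=[\mathcal{I}_{Lip}^{2},\mathcal{I}_{Lip}^{1}]$. (3) $\mathcal{I}_{Lip}^{1}=\mathcal{I}_{Lip}^{2}$.
   Context: Let $\mathbb{K}$ be $\mathbb{R}$ or $\mathbb{C}$; all Banach spaces are over $\mathbb{K}$. A pointed metric space is a metric space with a distinguished base point $0$. $Lip_0(X,Y)$ is the set of Lipschitz maps $T:X\to Y$ with $T(0)=0$ and $Lip(T)$ is the least Lipschitz constant; for a Banach space $E$, $Lip_0(X,E)$ is a Banach space under $Lip(\cdot)$; $X^{\#}=Lip_0(X,\mathbb{K})$. $\mathcal{L}(E,F)$ is the space of bounded linear operators. A map $T:X_1\times X_2\to E$ belongs to $BLip_0(X_1,X_2;E)$ if $T(x_1,0)=T(0,x_2)=0$ for all $x_1,x_2$ and there is $C>0$ with $\|T(x_1,x_2)-T(x_1,x_2')-T(x_1',x_2)+T(x_1',x_2')\|\le C\,d(x_1,x_1')d(x_2,x_2')$ for all $x_1,x_1'\in X_1$, $x_2,x_2'\in X_2$. A Lipschitz operator ideal $\mathcal{I}_{Lip}$ is a subclass of $Lip_0$ such that for every pointed metric space $X$ and Banach space $E$ the components $\mathcal{I}_{Lip}(X,E):=Lip_0(X,E)\cap\mathcal{I}_{Lip}$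 satisfy: (i) $\mathcal{I}_{Lip}(X,E)$ is a linear subspace of $Lip_0(X,E)$; (ii) $vg:x\mapsto g(x)v$ belongs to $\mathcal{I}_{Lip}(X,E)$ for $v\in E$, $g\in X^{\#}$; (iii) if $S\in Lip_0(Y,X)$, $T\in\mathcal{I}_{Lip}(X,E)$, $w\in\mathcal{L}(E,F)$, then $wTS\in\mathcal{I}_{Lip}(Y,F)$. Each $T\in BLip_0(X_1,X_2;E)$ has associated maps $T_1\in Lip_0(X_1,Lip_0(X_2,E))$ and $T_2\in Lip_0(X_2,Lip_0(X_1,E))$, $T_1(x_1)(x_2)=T(x_1,x_2)=T_2(x_2)(x_1)$. $T\in[\mathcal{I}_{Lip}^{1},\mathcal{I}_{Lip}^{2}](X_1,X_2;E)$ iff $T_1\in\mathcal{I}_{Lip}^{1}(X_1,Lip_0(X_2,E))$ and $T_2\in\mathcal{I}_{Lip}^{2}(X_2,Lip_0(X_1,E))$. For $T\in BLip_0(X,X;E)$, its symmetrization $T^s\in BLip_0(X,X;E)$ is $T^s(x_1,x_2)=\frac12(T(x_1,x_2)+T(x_2,x_1))$. A two-Lipschitz operator ideal $\mathcal{I}_{BLip}$ is symmetric if, for every pointed metric space $X$ and Banach space $E$, $T^s\in\mathcal{I}_{BLip}(X,X;E)$ whenever $T\in\mathcal{I}_{BLip}(X,X;E)$. Equalities of classes mean equality of all components. *)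

(* Defs.v *)
From HB Require Import structures.
From mathcomp Require Import all_boot all_order all_algebra.
From mathcomp Require Import complex.
From mathcomp Require Import all_classical all_reals all_analysis.

Set Implicit Arguments.
Unset Strict Implicit.
Unset Printing Implicit Defensive.

Import Order.TTheory GRing.Theory Num.Theory.
Import numFieldNormedType.Exports.

Local Open Scope classical_set_scope.
Local Open Scope ring_scope.

Variant scalars := real_scalars | complex_scalars.

Definition scalar_field (R : realType) (k : scalars) : numFieldType :=
  match k with
  | real_scalars => R
  | complex_scalars => (R[i])%C
  end.

(* Distances are valued in R, whereas MathComp-Analysis norms are valued in the
   scalar field K, so real bounds have to be embedded in K; the order of K = R[i]
   compares only numbers with the same imaginary part. *)
Definition of_real (R : realType) (k : scalars) : R -> scalar_field R k :=
  match k with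
  | real_scalars => id
  | complex_scalars => fun r => (r%:C)%C
  end.
Arguments of_real {R k} r.

Section of_real_theory.
Context (R : realType) (k : scalars).
Local Notation K := (scalar_field R k).
Implicit Types r s : R.

Lemma of_realD r s : of_real (r + s) = of_real r + of_real s :> K.
Proof. by case: k => //=; exact: rmorphD. Qed.

Lemma of_realM r s : of_real (r * s) = of_real r * of_real s :> K.
Proof. by case: k => //=; exact: rmorphM. Qed.

Lemma of_real0 : of_real 0 = 0 :> K.
Proof. by case: k. Qed.

Lemma ler_of_real r s : (of_real r <= of_real s :> K) = (r <= s).
Proof. by case: k => //=; exact: lecR. Qed.

Lemma ltr_of_real r s : (of_real r < of_real s :> K) = (r < s).
Proof. by case: k => //=; exact: ltcR. Qed.

Lemma of_real_ge0 r : (0 <= of_real r :> K) = (0 <= r).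
Proof. by rewrite -of_real0 ler_of_real. Qed.

Lemma ge0_of_real (z : K) : 0 <= z -> exists2 r, 0 <= r & z = of_real r.
Proof.
move=> z0; suff [r zr] : exists r, z = of_real r.
  by exists r => //; rewrite -of_real_ge0 -zr.
case: k z z0 => /= z z0; first by exists z.
by exists (complex.Re z); rewrite RRe_real// ger0_real.
Qed.

Lemma norm_of_real (V : normedModType K) (v : V) :
  exists2 r, 0 <= r & `|v| = of_real r.
Proof. exact: ge0_of_real. Qed.

End of_real_theory.

Record pointedMetric (R : realType) := PointedMetric {
  pm_sort :> metricType R;
  pm_base : pm_sort
}.
Arguments pm_base {R} p.

Section lip0.
Context (R : realType) (k : scalars).
Local Notation K := (scalar_field R k).
Context (X : pointedMetric R) (E : normedModType K).

Definition lip_bound (f : X -> E) : set R :=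
  [set C | 0 <= C /\ forall x y, `|f x - f y| <= of_real (C * mdist x y)].

Definition lip0_pred : {pred X -> E} :=
  mem [set f : X -> E | f (pm_base X) = 0 /\ lip_bound f !=set0].

Record lip0 := Lip0 { lip0_fun :> X -> E; lip0P : lip0_fun \in lip0_pred }.

(* The least Lipschitz constant Lip(f); the infimum is attained, see
   [lip_constP]. *)
Definition lip_const (f : X -> E) : R := inf (lip_bound f).

Lemma in_lip0 (f : X -> E) C :
  f (pm_base X) = 0 -> lip_bound f C -> f \in lip0_pred.
Proof. by move=> f0 fC; rewrite inE; split => //; exists C. Qed.

Lemma lip0_base (f : lip0) : f (pm_base X) = 0.
Proof. by have := lip0P f; rewrite inE => -[]. Qed.

Lemma lip0_bound (f : lip0) : lip_bound f !=set0.
Proof. by have := lip0P f; rewrite inE => -[]. Qed.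

Lemma lip_constP (f : X -> E) :
  lip_bound f !=set0 -> lip_bound f (lip_const f).
Proof.
move=> f0.
have c0 : 0 <= lip_const f by apply: lb_le_inf => // C [].
split=> // x y; have [-> | xy] := eqVneq x y.
  by rewrite subrr normr0 of_real_ge0 mulr_ge0// mdist_ge0.
have [r _ fr] := norm_of_real (f x - f y).
have d0 : 0 < mdist x y by rewrite mdist_gt0.
rewrite fr ler_of_real -ler_pdivrMr//; apply: lb_le_inf => // C [_ /(_ x y)].
by rewrite fr ler_of_real ler_pdivrMr.
Qed.

Lemma lip_const_le (f : X -> E) C : lip_bound f C -> lip_const f <= C.
Proof. by move=> fC; apply: ge_inf => //; exists 0 => D []. Qed.

Lemma lip_const_ge0 (f : X -> E) : lip_bound f !=set0 -> 0 <= lip_const f.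
Proof. by move=> /lip_constP[]. Qed.

Lemma lip_boundD (f g : X -> E) C D :
  lip_bound f C -> lip_bound g D -> lip_bound (f + g) (C + D).
Proof.
move=> [C0 fC] [D0 gD]; split=> [|x y]; first exact: addr_ge0.
rewrite mulrDl of_realD fctE opprD addrACA.
by rewrite (le_trans (ler_normD _ _))// lerD.
Qed.

Lemma lip_boundZ (a : K) r (f : X -> E) C : 0 <= r -> `|a| = of_real r ->
  lip_bound f C -> lip_bound (a *: f) (r * C).
Proof.
move=> r0 ar [C0 fC]; split=> [|x y]; first exact: mulr_ge0.
rewrite -mulrA of_realM fctE -scalerBr normrZ ar.
by rewrite ler_wpM2l ?of_real_ge0.
Qed.

Lemma lip0_submod_closed : submod_closed lip0_pred.
Proof.
split=> [|a f g].
  apply: (@in_lip0 _ 0) => //; split=> // x y.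
  by rewrite [X in `|X|](subrr (0 : E)) normr0 mul0r of_real0.
rewrite !inE => -[f0 [C fC]] [g0 [D gD]]; split.
  by rewrite /= fctE [LHS]/= fctE f0 g0 scaler0 addr0.
have [r r0 ar] := norm_of_real (a : K^o).
by exists (r * C + D); apply: lip_boundD => //; exact: lip_boundZ.
Qed.

HB.instance Definition _ :=
  GRing.isSubmodClosed.Build _ _ lip0_pred lip0_submod_closed.
HB.instance Definition _ := [isSub for lip0_fun].
HB.instance Definition _ := [Choice of lip0 by <:].
HB.instance Definition _ := [SubChoice_isSubLmodule of lip0 by <:].

Lemma lip0_ext (f g : lip0) : (forall x, f x = g x) -> f = g.
Proof. by move=> fg; apply: val_inj; apply/funext. Qed.

Lemma lip0D (f g : lip0) x : (f + g) x = f x + g x. Proof. by []. Qed.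
Lemma lip0N (f : lip0) x : (- f) x = - f x. Proof. by []. Qed.
Lemma lip0Z (a : K) (f : lip0) x : (a *: f) x = a *: f x. Proof. by []. Qed.

Definition lip0_norm (f : lip0) : K := of_real (lip_const f).

Lemma lip0_normD f g : lip0_norm (f + g) <= lip0_norm f + lip0_norm g.
Proof.
rewrite /lip0_norm -of_realD ler_of_real; apply: lip_const_le.
by apply: lip_boundD; apply: lip_constP; exact: lip0_bound.
Qed.

Let lip0_normZ_le (a : K) r (f : lip0) : 0 <= r -> `|a| = of_real r ->
  lip_const (a *: f) <= r * lip_const f.
Proof.
move=> r0 ar; apply: lip_const_le; apply: lip_boundZ => //.
exact/lip_constP/lip0_bound.
Qed.

Lemma lip0_normZ (a : K) f : lip0_norm (a *: f) = `|a| * lip0_norm f.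
Proof.
have [r r0 ar] := norm_of_real (a : K^o).
rewrite /lip0_norm [X in X * _]ar -of_realM; congr of_real.
apply/eqP; rewrite eq_le lip0_normZ_le//=.
have [r_eq0|r_neq0] := eqVneq r 0.
  by rewrite r_eq0 mul0r lip_const_ge0//; exact: (lip0_bound (a *: f)).
have a0 : a != 0.
  apply: contra_neq r_neq0 => a0; apply/eqP.
  rewrite eq_le r0 andbT -(ler_of_real k).
  by rewrite -ar a0 normr0 of_real0.
have rV0 : 0 <= r^-1 by rewrite invr_ge0.
have ar' : `|a^-1| = of_real r^-1.
  apply: (@mulfI _ `|a|); first by rewrite normr_eq0.
  rewrite -normrM divff// normr1 [X in X * _]ar -of_realM divff//.
  by case: (k).
have := lip0_normZ_le (a *: f) rV0 ar'.
rewrite -(@ler_pM2l _ r) ?lt_neqAle ?r0 1?eq_sym ?r_neq0//.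
by rewrite mulrA divff// mul1r scalerA mulVf// scale1r.
Qed.

Lemma lip0_norm_eq0 f : lip0_norm f = 0 -> f = 0.
Proof.
move=> f0; apply: lip0_ext => x; apply/eqP.
have [_ /(_ x (pm_base X))] := lip_constP (lip0_bound f).
rewrite lip0_base subr0 of_realM -/(lip0_norm f) f0 mul0r.
by rewrite normr_le0.
Qed.

HB.instance Definition _ :=
  Lmodule_isNormed.Build K lip0 lip0_normD lip0_normZ lip0_norm_eq0.

Lemma lip0_normE (f : lip0) : `|f| = of_real (lip_const f) :> K.
Proof. by []. Qed.

End lip0.
Arguments lip0_pred {R k X E}.
Arguments lip_bound {R k X E}.

Section lip0_complete.
Context (R : realType) (k : scalars).
Local Notation K := (scalar_field R k).
Context (X : pointedMetric R) (E : completeNormedModType K).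
Local Notation L := (lip0 X E).

Let norm_lipP (h : L) x y : `|h x - h y| <= `|h| * of_real (mdist x y).
Proof.
have [_ /(_ x y)] := lip_constP (lip0_bound h).
by rewrite of_realM.
Qed.

Lemma lip0_cauchy_cvg (F : set_system L) :
  ProperFilter F -> cauchy F -> cvg F.
Proof.
move=> FF Fc.
have Fc' (e : R) : 0 < e -> exists2 A, F A &
    forall f g, A f -> A g -> `|f - g| <= of_real e :> K.
  move=> e0; have ek : 0 < of_real e :> K by rewrite -of_real0 ltr_of_real.
  have /cauchy_ballP/(_ _ ek) [[A B] /= [FA FB] AB] := Fc.
  exists (A `&` B); first exact: filterI.
  move=> f g [Af _] [_ Bg]; have /AB/= : (A `*` B) (f, g) by [].
  by rewrite -ball_normE /= => /ltW.
have pt x : cvg ((fun f : L => f x) @ F).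
  apply: cauchy_cvg; apply/cauchy_ballP => e e0.
  have [r r0 er] := ge0_of_real (ltW e0).
  pose d := mdist x (pm_base X).
  have d0 : 0 <= d by exact: mdist_ge0.
  have r0' : 0 < r by rewrite -(ltr_of_real k) -er of_real0.
  have d1 : 0 < d + 1 by rewrite ltr_wpDl.
  have [A FA AA] := Fc' _ (divr_gt0 r0' d1).
  exists ([set f x | f in A], [set f x | f in A]) => /=.
    by split; apply: (@filterS _ F _ A) => // f Af; exists f.
  move=> [_ _] /= [[f Af <-] [g Ag <-]].
  rewrite -ball_normE /=.
  have := norm_lipP (f - g) x (pm_base X).
  rewrite !lip0_base subr0 lip0D lip0N => /le_lt_trans; apply.
  rewrite (@le_lt_trans _ _ (of_real (r / (d + 1)) * of_real d))//.
    by rewrite ler_wpM2r ?of_real_ge0// AA.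
  rewrite -of_realM er ltr_of_real mulrAC ltr_pdivrMr//.
  by rewrite ltr_pM2l// ltrDl.
pose g x : E := lim ((fun f : L => f x) @ F).
have key (e : R) : 0 < e -> exists2 A, F A &
    forall f, A f -> lip_bound ((f : X -> E) - g) e.
  move=> e0; have [A FA AA] := Fc' _ e0.
  exists A => // f Af; split=> [|x y]; first exact: ltW.
  apply/ler_addgt0Pr => d d0.
  have d20 : 0 < d / 2 by rewrite divr_gt0.
  have /cvgrPdist_le/(_ _ d20) gx := pt x.
  have /cvgrPdist_le/(_ _ d20) gy := pt y.
  have [h [[/= hx hy] Ah]] := filter_ex (filterI (filterI gx gy) FA).
  have fgh z : f z - h z = (f z - g z) + (g z - h z) by rewrite addrA subrK.
  have -> : ((f : X -> E) - g) x - ((f : X -> E) - g) y =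
      ((f - h) x - (f - h) y) + ((g y - h y) - (g x - h x)).
    change (f x - g x - (f y - g y) =
      ((f x - h x) - (f y - h y)) + ((g y - h y) - (g x - h x))).
    rewrite !fgh; move: (f x - g x) (f y - g y) (g x - h x) (g y - h y).
    by move=> a b u v; rewrite (opprD b) [X in _ = X + _]addrACA -(opprB u) addrK.
  rewrite (le_trans (ler_normD _ _))// lerD//.
    rewrite (le_trans (norm_lipP _ _ _))// of_realM ler_wpM2r ?of_real_ge0//.
      exact: mdist_ge0.
    exact: AA.
  rewrite (le_trans (ler_normB _ _))// [leRHS]splitr lerD//.
have g0 : g (pm_base X) = 0.
  rewrite /g; under eq_fun do rewrite lip0_base.
  exact: lim_cst.
have [A FA Ag] := key 1 ltr01.
have [f Af] := filter_ex FA.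
have gP : g \in lip0_pred.
  have -> : g = (f : X -> E) - ((f : X -> E) - g) by rewrite opprB addrC subrK.
  apply: rpredB; first exact: lip0P.
  by apply: in_lip0 (Ag _ Af); rewrite fctE [LHS]/= fctE lip0_base g0 subrr.
apply/cvg_ex; exists (Lip0 gP); apply/cvgrPdist_le => e e0.
have [r r0 er] := ge0_of_real (ltW e0).
have r0' : 0 < r by rewrite -(ltr_of_real k) -er of_real0.
have [B FB Bg] := key r r0'.
apply: filterS FB => h /Bg hg; rewrite distrC lip0_normE er ler_of_real.
exact: lip_const_le.
Unshelve. all: by end_near. Qed.

HB.instance Definition _ := Uniform_isComplete.Build L lip0_cauchy_cvg.

End lip0_complete.

Record lip_map (R : realType) (Y X : pointedMetric R) := LipMap {
  lip_map_fun :> Y -> X;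
  lip_map_base : lip_map_fun (pm_base Y) = pm_base X;
  lip_map_bound : exists2 C, 0 <= C &
    forall x y, mdist (lip_map_fun x) (lip_map_fun y) <= C * mdist x y
}.

Record bounded_operator (K : numFieldType) (E F : normedModType K) :=
  BoundedOperator {
    bounded_operator_fun :> {linear E -> F};
    bounded_operatorP : bounded_near bounded_operator_fun (nbhs (0 : E))
  }.

Section lip0_constructions.
Context (R : realType) (k : scalars).
Local Notation K := (scalar_field R k).
Implicit Types (X Y : pointedMetric R) (E F : normedModType K).

Lemma bounded_operator_le E F (w : bounded_operator E F) :
  exists2 M : R, 0 <= M & forall v, `|w v| <= of_real M * `|v|.
Proof.
have /linear_boundedP/pinfty_ex_gt0 [z z0 wz] := bounded_operatorP w.
have [M M0 zM] := ge0_of_real (ltW z0).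
by exists M => // v; rewrite -zM.
Qed.

Lemma lip0_comp_subproof X Y E F
    (w : bounded_operator E F) (T : lip0 X E) (S : lip_map Y X) :
  (fun y => w (T (S y))) \in lip0_pred.
Proof.
have [M M0 wM] := bounded_operator_le w.
have [C [C0 TC]] := lip0_bound T.
have [D D0 SD] := lip_map_bound S.
apply: (@in_lip0 _ _ _ _ _ (M * C * D)).
  by rewrite lip_map_base lip0_base linear0.
split=> [|x y]; first by rewrite !mulr_ge0.
rewrite -linearB (le_trans (wM _))// -!mulrA of_realM.
rewrite ler_wpM2l ?of_real_ge0// (le_trans (TC _ _))// ler_of_real.
by rewrite ler_wpM2l.
Qed.

Definition lip0_comp X Y E F
    (w : bounded_operator E F) (T : lip0 X E) (S : lip_map Y X) : lip0 Y F :=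
  Lip0 (lip0_comp_subproof w T S).

Lemma lip0_rank1_subproof X E (g : lip0 X K^o) (v : E) :
  (fun x => (g x : K) *: v) \in lip0_pred.
Proof.
have [C [C0 gC]] := lip0_bound g.
have [r r0 vr] := norm_of_real v.
apply: (@in_lip0 _ _ _ _ _ (C * r)); first by rewrite lip0_base scale0r.
split=> [|x y]; first exact: mulr_ge0.
by rewrite -scalerBl normrZ vr mulrAC of_realM ler_wpM2r ?of_real_ge0.
Qed.

Definition lip0_rank1 X E (g : lip0 X K^o) (v : E) : lip0 X E :=
  Lip0 (lip0_rank1_subproof g v).

End lip0_constructions.

Record lip_ideal (R : realType) (k : scalars) := LipIdeal {
  in_ideal :> forall (X : pointedMetric R)
    (E : completeNormedModType (scalar_field R k)), set (lip0 X E);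
  ideal0 : forall X (E : completeNormedModType (scalar_field R k)),
    in_ideal (0 : lip0 X E);
  idealD : forall X (E : completeNormedModType (scalar_field R k))
    (f g : lip0 X E),
    in_ideal f -> in_ideal g -> in_ideal (f + g);
  idealZ : forall X (E : completeNormedModType (scalar_field R k))
    (a : scalar_field R k) (f : lip0 X E),
    in_ideal f -> in_ideal (a *: f);
  ideal_rank1 : forall X (E : completeNormedModType (scalar_field R k))
    (g : lip0 X (scalar_field R k)^o) (v : E), in_ideal (lip0_rank1 g v);
  ideal_comp : forall X Y (E F : completeNormedModType (scalar_field R k))
    (w : bounded_operator E F) (T : lip0 X E) (S : lip_map Y X),
    in_ideal T -> in_ideal (lip0_comp w T S)
}.
Arguments in_ideal {R k} l X E : rename.

Section blip0.
Context (R : realType) (k : scalars).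
Local Notation K := (scalar_field R k).

Record blip0 (X1 X2 : pointedMetric R) (E : normedModType K) := BLip0 {
  blip0_fun :> X1 -> X2 -> E;
  blip0_basel : forall x2, blip0_fun (pm_base X1) x2 = 0;
  blip0_baser : forall x1, blip0_fun x1 (pm_base X2) = 0;
  blip0_bound : exists2 C : R, 0 < C & forall x1 x1' x2 x2',
    `|blip0_fun x1 x2 - blip0_fun x1 x2' - blip0_fun x1' x2
        + blip0_fun x1' x2'|
      <= of_real (C * mdist x1 x1' * mdist x2 x2')
}.

Implicit Types (X : pointedMetric R) (E : normedModType K).

Lemma blip0_swap_bound X1 X2 E (T : blip0 X1 X2 E) :
  exists2 C : R, 0 < C & forall x2 x2' x1 x1',
    `|T x1 x2 - T x1' x2 - T x1 x2' + T x1' x2'|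
      <= of_real (C * mdist x2 x2' * mdist x1 x1').
Proof.
have [C C0 TC] := blip0_bound T; exists C => // x2 x2' x1 x1'.
by rewrite (addrAC (T x1 x2)) mulrAC; exact: TC.
Qed.

Definition blip0_swap X1 X2 E (T : blip0 X1 X2 E) : blip0 X2 X1 E :=
  @BLip0 X2 X1 E (fun x2 x1 => T x1 x2) (blip0_baser T) (blip0_basel T)
    (blip0_swap_bound T).

Lemma blip0_assoc1_subproof1 X1 X2 E (T : blip0 X1 X2 E) x1 :
  T x1 \in lip0_pred.
Proof.
have [C C0 TC] := blip0_bound T.
apply: (@in_lip0 _ _ _ _ _ (C * mdist x1 (pm_base X1))).
  exact: blip0_baser.
split=> [|x y]; first by rewrite mulr_ge0 ?(ltW C0) ?mdist_ge0.
by have := TC x1 (pm_base X1) x y; rewrite !blip0_basel subr0 addr0.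
Qed.

Lemma blip0_assoc1_subproof2 X1 X2 E (T : blip0 X1 X2 E) :
  (fun x1 => Lip0 (blip0_assoc1_subproof1 T x1)) \in lip0_pred.
Proof.
have [C C0 TC] := blip0_bound T.
apply: (@in_lip0 _ _ _ _ _ C).
  by apply: lip0_ext => x2; exact: blip0_basel.
split=> [|x y]; first exact: ltW.
rewrite lip0_normE ler_of_real; apply: lip_const_le.
split=> [|x2 y2]; first by rewrite mulr_ge0 ?(ltW C0) ?mdist_ge0.
change (`|T x x2 - T y x2 - (T x y2 - T y y2)|
  <= of_real (C * mdist x y * mdist x2 y2) :> K).
by rewrite (opprD (T x y2)) opprK addrA (addrAC (T x x2)); exact: TC.
Qed.

Definition blip0_assoc1 X1 X2 E (T : blip0 X1 X2 E) : lip0 X1 (lip0 X2 E) :=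
  Lip0 (blip0_assoc1_subproof2 T).

Definition blip0_assoc2 X1 X2 E (T : blip0 X1 X2 E) : lip0 X2 (lip0 X1 E) :=
  blip0_assoc1 (blip0_swap T).

Lemma blip0_assoc1E X1 X2 E (T : blip0 X1 X2 E) x1 x2 :
  blip0_assoc1 T x1 x2 = T x1 x2.
Proof. by []. Qed.

Lemma blip0_assoc2E X1 X2 E (T : blip0 X1 X2 E) x1 x2 :
  blip0_assoc2 T x2 x1 = T x1 x2.
Proof. by []. Qed.

Section blip0_sym.
Context X E (T : blip0 X X E).

Let sym x1 x2 : E := (2^-1 : K) *: (T x1 x2 + T x2 x1).

Let sym_basel x : sym (pm_base X) x = 0.
Proof. by rewrite /sym blip0_basel blip0_baser addr0 scaler0. Qed.

Let sym_baser x : sym x (pm_base X) = 0.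
Proof. by rewrite /sym blip0_basel blip0_baser addr0 scaler0. Qed.

Let sym_bound : exists2 C : R, 0 < C & forall x1 x1' x2 x2',
  `|sym x1 x2 - sym x1 x2' - sym x1' x2 + sym x1' x2'|
    <= of_real (C * mdist x1 x1' * mdist x2 x2').
Proof.
have [C C0 TC] := blip0_bound T; have [D D0 TD] := blip0_bound (blip0_swap T).
exists (C + D); first exact: addr_gt0.
move=> x1 x1' x2 x2'; rewrite /sym -!scalerBr -scalerDr normrZ.
have -> : T x1 x2 + T x2 x1 - (T x1 x2' + T x2' x1)
      - (T x1' x2 + T x2 x1') + (T x1' x2' + T x2' x1')
    = (T x1 x2 - T x1 x2' - T x1' x2 + T x1' x2')
      + (T x2 x1 - T x2' x1 - T x2 x1' + T x2' x1').
  by rewrite (addrACA _ (T x1' x2')) (addrACA _ (- T x1' x2))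
    (addrACA (T x1 x2)) -!opprD.
have h2 : `|2^-1 : K| <= 1 by rewrite normfV normr_nat invf_le1// ler1n.
rewrite -[leRHS]mul1r ler_pM// (le_trans (ler_normD _ _))//.
by rewrite !mulrDl of_realD lerD//; exact: TD.
Qed.

Definition blip0_sym : blip0 X X E := BLip0 sym_basel sym_baser sym_bound.

Lemma blip0_symE x1 x2 :
  blip0_sym x1 x2 = (2^-1 : K) *: (T x1 x2 + T x2 x1).
Proof. by []. Qed.

End blip0_sym.
End blip0.

Definition two_lip_class (R : realType) (k : scalars) :=
  forall (X1 X2 : pointedMetric R)
    (E : completeNormedModType (scalar_field R k)), set (blip0 X1 X2 E).

Definition two_lip_symmetric (R : realType) (k : scalars)
    (I : two_lip_class R k) :=
  forall (X : pointedMetric R) (E : completeNormedModType (scalar_field R k))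
    (T : blip0 X X E), I X X E T -> I X X E (blip0_sym T).

Definition ideal_bracket (R : realType) (k : scalars) (I1 I2 : lip_ideal R k) :
    two_lip_class R k :=
  fun X1 X2 E => [set T | I1 X1 (lip0 X2 E) (blip0_assoc1 T) /\
                          I2 X2 (lip0 X1 E) (blip0_assoc2 T)].

Definition two_lip_eq (R : realType) (k : scalars) (I J : two_lip_class R k) :=
  forall X1 X2 E, I X1 X2 E = J X1 X2 E.

Definition lip_ideal_eq (R : realType) (k : scalars) (I J : lip_ideal R k) :=
  forall X E, I X E = J X E.

(* Main.v *)
Require Import Defs.
From HB Require Import structures.
From mathcomp Require Import all_boot all_order all_algebra.
From mathcomp Require Import all_classical all_reals all_analysis.

Set Implicit Arguments.
Unset Strict Implicit.
Unset Printing Implicit Defensive.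

Import Order.TTheory GRing.Theory Num.Theory.
Import numFieldNormedType.Exports.

Local Open Scope classical_set_scope.
Local Open Scope ring_scope.

(** Everything rests on one family of two-Lipschitz maps. For [T : X -> E] and
    a scalar Lipschitz function [g] on [X], put [B x y = g y *: T x]. Its first
    associated map is [T] followed by the bounded operator that sends [v] to
    [y |-> g y *: v], and its second one is [y |-> g y *: T], of rank one.
    Since every ideal contains the rank-one maps and is stable under
    composition, [B] lies in [[I, J]] as soon as [T] lies in [I], whatever [J] is
    ([ideal_bracket_tensor]).

    To recover [T] from [B], choose [g] with [g a = 1] at some point [a]
    (a normalised distance to the base point; if [X] is reduced to its base
    point then [T = 0]) and evaluate at [a].
    - If [[I, J]] is contained in [[J, I]], then the first associated map of
      [B] is in [J], and its value at [a] is [T]: hence [T] is in [J]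
      ([ideal_sub_of_bracket_sub]).
    - If [[I, J]] is symmetric, the second associated map of [B^s], evaluated
      at [a], is [x |-> (g x *: T a + T x) / 2]. It is in [J], and it differs
      from [T / 2] by a rank-one map: again [T] is in [J]
      ([ideal_sub_of_symmetric]).
    The symmetry of [[I, J]] and the equality of [[I, J]] with [[J, I]] are both
    stable under exchanging [I] and [J], so each of them yields [I = J].

    Conversely, when [T] is defined on [X * X], both associated maps of [T^s]
    equal [(T_1 + T_2) / 2], which is in [I] whenever [T_1] and [T_2] are, so [[I, I]] is symmetric. *)

(** * Elementary Lipschitz maps and bounded operators *)

Lemma norm_le_bounded_near (R : realType) (k : scalars)
    (E F : normedModType (scalar_field R k)) (f : {linear E -> F}) (C : R) :
  0 <= C -> (forall v, `|f v| <= `|v| * of_real C) ->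
  bounded_near f (nbhs (0 : E)).
Proof.
move=> C0 fC; apply/linear_boundedP; near=> r => v.
rewrite (le_trans (fC v))// mulrC ler_wpM2r//; near: r.
apply: nbhs_pinfty_ge; rewrite realE of_real_ge0 C0//.
Unshelve. all: by end_near. Qed.

Lemma norm_of_realE (R : realType) (k : scalars) (r : R) :
  `|of_real r : scalar_field R k| = of_real `|r|.
Proof.
have of_realN s : of_real (- s) = - of_real s :> scalar_field R k.
  by apply/eqP; rewrite -subr_eq0 opprK -of_realD addNr of_real0.
have [r0|/ltW r0] := leP 0 r; first by rewrite !ger0_norm ?of_real_ge0.
by rewrite -[LHS]normrN -of_realN ger0_norm ?of_real_ge0 ?oppr_ge0// ler0_norm.
Qed.

Section elementary_maps.
Context (R : realType) (k : scalars).
Local Notation K := (scalar_field R k).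
Implicit Types (X : pointedMetric R) (E : normedModType K).

Lemma norm_lip0_le X E (f : lip0 X E) x :
  `|f x| <= `|f| * of_real (mdist x (pm_base X)).
Proof.
have [_ /(_ x (pm_base X))] := lip_constP (lip0_bound f).
by rewrite lip0_base subr0 of_realM.
Qed.

Section evaluation.
Context X E (a : X).

Definition lip0_ev (f : lip0 X E) : E := f a.

Let lip0_ev_linear : linear lip0_ev. Proof. by []. Qed.
HB.instance Definition _ :=
  GRing.isLinear.Build K (lip0 X E) E *:%R lip0_ev lip0_ev_linear.

Let lip0_ev_bounded : bounded_near lip0_ev (nbhs (0 : lip0 X E)).
Proof.
apply: norm_le_bounded_near (mdist_ge0 a (pm_base X)) _ => f.
exact: norm_lip0_le.
Qed.

Definition ev_operator : bounded_operator (lip0 X E) E :=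
  @BoundedOperator _ _ _ lip0_ev lip0_ev_bounded.
End evaluation.

Section scaling.
Context X E (g : lip0 X K^o).

Let lip0_rank1_linear : linear (@lip0_rank1 R k X E g).
Proof.
move=> c u v; apply: lip0_ext => x.
by rewrite lip0D lip0Z /= scalerDr !scalerA mulrC.
Qed.
HB.instance Definition _ :=
  GRing.isLinear.Build K E (lip0 X E) *:%R (@lip0_rank1 R k X E g)
    lip0_rank1_linear.

Let lip0_rank1_le (v : E) : `|lip0_rank1 g v| <= `|v| * of_real (lip_const g).
Proof.
have [r r0 vr] := norm_of_real v; rewrite vr lip0_normE -of_realM ler_of_real.
have [g0 gC] := lip_constP (lip0_bound g).
apply: lip_const_le; split=> [|x y]; first exact: mulr_ge0.
by rewrite -scalerBl normrZ vr mulrC -mulrA of_realM ler_wpM2l ?of_real_ge0.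
Qed.

Let lip0_rank1_bounded :
  bounded_near (@lip0_rank1 R k X E g) (nbhs (0 : E)).
Proof.
apply: norm_le_bounded_near lip0_rank1_le.
exact: lip_const_ge0 (lip0_bound g).
Qed.

Definition rank1_operator : bounded_operator E (lip0 X E) :=
  @BoundedOperator _ _ _ (@lip0_rank1 R k X E g) lip0_rank1_bounded.
End scaling.

Lemma lip_id_bound X :
  exists2 C : R, 0 <= C & forall x y : X, mdist x y <= C * mdist x y.
Proof. by exists 1 => // x y; rewrite mul1r. Qed.

Definition lip_id X : lip_map X X :=
  @LipMap _ X X id erefl (lip_id_bound X).

(** The distance to the base point, divided by its value at [a]. *)
Lemma separating_lip0 X (a : X) : a <> pm_base X ->
  exists g : lip0 X K^o, g a = 1.
Proof.
move=> /eqP a0; have d0 : 0 < mdist a (pm_base X) by rewrite mdist_gt0.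
pose D := mdist a (pm_base X).
pose g (x : X) : K^o := of_real (mdist x (pm_base X) / D).
have gP : g \in lip0_pred.
  apply: (@in_lip0 _ _ _ _ _ D^-1); first by rewrite /g mdistxx mul0r of_real0.
  split=> [|x y]; first by rewrite invr_ge0 ltW.
  have -> : g x - g y = of_real ((mdist x (pm_base X) - mdist y (pm_base X)) / D).
    by apply/eqP; rewrite subr_eq /g -of_realD mulrBl subrK.
  rewrite norm_of_realE ler_of_real normrM [`|D^-1|]gtr0_norm ?invr_gt0//.
  rewrite mulrC ler_pM2l ?invr_gt0// ler_distl lerBlDr.
  rewrite ![_ + mdist x y]addrC metric_triangle andbT.
  by rewrite [mdist x y]metric_sym metric_triangle.
exists (Lip0 gP); rewrite /= /g divff ?gt_eqF//; by case: (k).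
Qed.

(** * Elementary tensors and symmetrization *)

Section tensor.
Context X1 X2 E (T : lip0 X1 E) (g : lip0 X2 K^o).

Let tensor x1 x2 : E := (g x2 : K) *: T x1.

Let tensor_basel x : tensor (pm_base X1) x = 0.
Proof. by rewrite /tensor lip0_base scaler0. Qed.

Let tensor_baser x : tensor x (pm_base X2) = 0.
Proof. by rewrite /tensor lip0_base scale0r. Qed.

Let tensor_bound : exists2 C : R, 0 < C & forall x1 x1' x2 x2',
  `|tensor x1 x2 - tensor x1 x2' - tensor x1' x2 + tensor x1' x2'|
    <= of_real (C * mdist x1 x1' * mdist x2 x2').
Proof.
have [C [C0 TC]] := lip0_bound T; have [D [D0 gD]] := lip0_bound g.
(* The constant of a two-Lipschitz map is required to be positive, and
   [C * D] may vanish. *)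
exists (C * D + 1) => [|x1 x1' x2 x2']; first by rewrite ltr_wpDl ?mulr_ge0.
have -> : tensor x1 x2 - tensor x1 x2' - tensor x1' x2 + tensor x1' x2'
    = (g x2 - g x2' : K) *: (T x1 - T x1').
  rewrite /tensor scalerBr !scalerBl opprB addrA addrAC.
  by rewrite -!addrA; congr (_ + (_ + _)); rewrite addrC.
rewrite normrZ (le_trans (ler_pM _ _ (gD _ _) (TC _ _)))//.
rewrite -of_realM ler_of_real mulrACA (mulrC D) (mulrC (mdist x2 _)) !mulrA.
by rewrite -mulrA -[leRHS]mulrA ler_wpM2r ?mulr_ge0 ?mdist_ge0// lerDl.
Qed.

Definition blip0_tensor : blip0 X1 X2 E :=
  BLip0 tensor_basel tensor_baser tensor_bound.

Lemma blip0_tensor_assoc1 :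
  blip0_assoc1 blip0_tensor = lip0_comp (rank1_operator E g) T (lip_id X1).
Proof. by do 2![apply: lip0_ext => ?]. Qed.

Lemma blip0_tensor_assoc2 : blip0_assoc2 blip0_tensor = lip0_rank1 g T.
Proof. by do 2![apply: lip0_ext => ?]. Qed.

End tensor.

Lemma blip0_swapK X1 X2 E (T : blip0 X1 X2 E) : blip0_swap (blip0_swap T) = T.
Proof.
by case: T => f fl fr fb; congr BLip0; exact: Prop_irrelevance.
Qed.

Lemma blip0_sym_assoc1 X E (T : blip0 X X E) :
  blip0_assoc1 (blip0_sym T) =
    (2^-1 : K) *: (blip0_assoc1 T + blip0_assoc2 T).
Proof. by do 2![apply: lip0_ext => ?]. Qed.

(** [blip0_sym T] is a symmetric function, so that membership of it in a
    bracket is a condition on a single map. *)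
Lemma blip0_sym_assoc2 X E (T : blip0 X X E) :
  blip0_assoc2 (blip0_sym T) = blip0_assoc1 (blip0_sym T).
Proof.
apply: lip0_ext => x; apply: lip0_ext => y.
by rewrite blip0_assoc2E blip0_assoc1E !blip0_symE addrC.
Qed.

End elementary_maps.

(** * Comparing two ideals through their bracket *)

Section ideals.
Context (R : realType) (k : scalars).
Local Notation K := (scalar_field R k).
Implicit Types (I J : lip_ideal R k).

(** The second ideal is arbitrary because the second associated map of a tensor
    has rank one. *)
Lemma ideal_bracket_tensor I J (X1 X2 : pointedMetric R)
    (E : completeNormedModType K) (T : lip0 X1 E) (g : lip0 X2 K^o) :
  I X1 E T -> ideal_bracket I J (blip0_tensor T g).
Proof.
move=> IT; split.
  by rewrite blip0_tensor_assoc1; exact: ideal_comp.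
rewrite blip0_tensor_assoc2; exact: ideal_rank1.
Qed.

(** Evaluation at [a] is a bounded operator from [lip0 X2 E] to [E]. *)
Lemma ideal_ev I (X1 X2 : pointedMetric R)
    (E : completeNormedModType K) (T : lip0 X1 (lip0 X2 E)) (a : X2)
    (S : lip0 X1 E) :
  (forall x, T x a = S x) -> I X1 (lip0 X2 E) T -> I X1 E S.
Proof.
move=> TS /(ideal_comp (ev_operator E a) (lip_id X1)).
by congr (I _ _ _); apply: lip0_ext => x; exact: TS.
Qed.

(** A space reduced to its base point carries no [g] with [g a = 1], but then
    the only map is [0], which belongs to every ideal. *)
Lemma ideal_sub_of_separated I J :
  (forall X (E : completeNormedModType K) (T : lip0 X E) (a : X)
     (g : lip0 X K^o), g a = 1 -> I X E T -> J X E T) ->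
  forall X E, I X E `<=` J X E.
Proof.
move=> IJ X E T IT.
have [[a a0]|X0] := pselect (exists a, a <> pm_base X).
  have [g ga] := separating_lip0 k a0; exact: (IJ _ _ _ a g).
suff -> : T = 0 by exact: ideal0.
apply: lip0_ext => x; have [->|x0] := eqVneq x (pm_base X).
  by rewrite lip0_base.
by case: X0; exists x; exact/eqP.
Qed.

(** The first associated map of the tensor [g y *: T x] takes the value
    [g a *: T = T] at [a]. *)
Lemma ideal_sub_of_bracket_sub I J :
  (forall X E, @ideal_bracket R k I J X X E `<=` @ideal_bracket R k J I X X E) ->
  forall X E, I X E `<=` J X E.
Proof.
move=> IJ; apply: ideal_sub_of_separated => X E T a g ga IT.
have [JB _] := IJ _ _ _ (ideal_bracket_tensor J g IT).
apply: (@ideal_ev J _ _ _ _ a _ _ JB) => x.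
by rewrite blip0_assoc1E /= ga scale1r.
Qed.

(** The symmetrized tensor has both associated maps equal to
    [x |-> y |-> (g y *: T x + g x *: T y) / 2]; at [y = a] this is [T / 2] up to
    the rank-one map [x |-> g x *: T a / 2]. *)
Lemma ideal_sub_of_symmetric I J :
  two_lip_symmetric (ideal_bracket I J) -> forall X E, I X E `<=` J X E.
Proof.
move=> symIJ; apply: ideal_sub_of_separated => X E T a g ga IT.
have [_ JB] := symIJ _ _ _ (ideal_bracket_tensor J g IT).
(* The rank-one term is removed before evaluating, so that evaluation gives
   exactly [T]. *)
have := idealD (idealZ 2 JB) (ideal_rank1 J g (- T)).
apply: (@ideal_ev J _ _ _ _ a) => x.
transitivity ((2 : K) *: ((2^-1 : K) *: ((g x : K) *: T a + (g a : K) *: T x))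
  + (g x : K) *: - T a) => //.
rewrite scalerA divff ?pnatr_eq0// scale1r ga scale1r.
by rewrite scalerN addrAC subrr add0r.
Qed.

Lemma ideal_bracket_swap I J X1 X2 (E : completeNormedModType K)
    (T : blip0 X1 X2 E) :
  ideal_bracket I J T <-> ideal_bracket J I (blip0_swap T).
Proof. by rewrite /ideal_bracket /= /blip0_assoc2 blip0_swapK; split=> -[]. Qed.

(** Swapping the variables exchanges the two ideals and does not change the
    symmetrization. *)
Lemma two_lip_symmetric_swap I J :
  two_lip_symmetric (ideal_bracket I J) ->
  two_lip_symmetric (ideal_bracket J I).
Proof.
move=> symIJ X E T /ideal_bracket_swap/symIJ[].
rewrite /ideal_bracket /= !blip0_sym_assoc2 !blip0_sym_assoc1.
by rewrite /blip0_assoc2 blip0_swapK addrC; split.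
Qed.

Lemma ideal_bracket_self_symmetric I : two_lip_symmetric (ideal_bracket I I).
Proof.
move=> X E T [T1 T2]; rewrite /ideal_bracket /=.
rewrite blip0_sym_assoc2 blip0_sym_assoc1.
by split; apply: idealZ; exact: idealD.
Qed.

Lemma ideal_bracket_congr I J I' J' :
  lip_ideal_eq I I' -> lip_ideal_eq J J' ->
  two_lip_eq (ideal_bracket I J) (ideal_bracket I' J').
Proof. by move=> II JJ X1 X2 E; rewrite /ideal_bracket II JJ. Qed.

End ideals.

Theorem theorem5p8 (R : realType) (k : scalars) (I1 I2 : lip_ideal R k) :
  [<-> two_lip_symmetric (ideal_bracket I1 I2);
       two_lip_eq (ideal_bracket I1 I2) (ideal_bracket I2 I1);
       lip_ideal_eq I1 I2].
Proof.
tfae.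
- move=> symI.
  have I12 : lip_ideal_eq I1 I2.
    move=> X E; apply/seteqP; split; apply: ideal_sub_of_symmetric => //.
    exact: two_lip_symmetric_swap.
  by apply: ideal_bracket_congr => // X E; rewrite I12.
- move=> eqI X E; apply/seteqP; split; apply: ideal_sub_of_bracket_sub => Y F.
    by rewrite eqI.
  by rewrite eqI.
- move=> I12 X E T.
  rewrite (@ideal_bracket_congr _ _ I1 I2 I2 I2 I12 (fun _ _ => erefl)).
  exact: ideal_bracket_self_symmetric.
Qed.
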